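(* Let $E$ be an admissible $A$-module scheme over $S$ with $\varphi_E(t)=\pi\tau^0+\sum_{i\ge1}a_i\tau^i$. Suppose $q\ge3$ and $a_i\in\pi^{q^i-1}R$ for all $i\ge1$. Then there exists a unique $A$-linear homomorphism $f:E\to\hat{\mathbb G}_a$, written $f=\sum_{i\ge0}b_i\tau^i$, such that $b_i\in\pi^iR$ for all $i$ and $b_0=1$. Moreover, $f$ is an isomorphism of $A$-module schemes over $S$.
   Context: Let $q=p^h$, $A=\mathcal O(X\setminus\{\infty\})$ for a projective, geometrically connected, smooth curve $X$ over $\mathbb F_q$ and $\infty\in X(\mathbb F_q)$; $\mathfrak p\subset A$ a maximal ideal, $\hat A$ the $\mathfrak p$-adic completion, $t\in\mathfrak p\setminus\mathfrak p^2$ with image $\pi\in\hat A$. $R$ is an $\hat A$-algebra which is $\pi$-adically complete and $\pi$-torsion free, $\theta:A\to R$ the structure map, $S=\mathrm{Spf}R$. $\hat{\mathbb G}_a=\mathrm{Spf}R\langle x\rangle$, with $A$-module structure $a\mapsto\theta(a)\tau^0$. $R\{\tau\}^\wedge$ is the set of sums $\sum_{i\ge0}b_i\tau^i$ with $b_i\in R$, $b_i\to0$ $\pi$-adically, acting on $\hat{\mathbb G}_a$ by $x\mapsto\sum b_ix^{q^i}$, composition $b\tau^i\circ c\tau^j=bc^{q^i}\tau^{i+j}$. An admissible $A$-module scheme over $S$ is $\hat{\mathbb G}_a$ with a ring homomorphism $\varphi_E:A\to R\{\tau\}^\wedge$ such that the $\tau^0$-coefficient of $\varphi_E(a)$ is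 $\theta(a)$ for all $a$. An $A$-linear homomorphism $E\to G$ is an $f\in R\{\tau\}^\wedge$ with $f\circ\varphi_E(a)=\varphi_G(a)\circ f$ for all $a\in A$. *)

(* Defs.v *)
From HB Require Import structures.
From mathcomp Require Import all_boot all_order all_algebra.
From mathcomp Require Import all_fingroup all_solvable all_field.
From mathcomp Require Import boolp classical_sets functions.

Set Implicit Arguments.
Unset Strict Implicit.
Unset Printing Implicit Defensive.

Import GRing.Theory.
Local Open Scope ring_scope.

(* A smooth projective geometrically connected curve X over the finite field F
   is given by its function field K: a finitely generated extension of F of
   transcendence degree one in which F is algebraically closed.  The closed
   points of X are the valuation rings of K/F (the local rings of X), the
   degree of a point is that of its residue field over F, and the functions
   regular on an open subset are the elements of K lying in all the
   corresponding local rings.  As F is perfect, X is geometrically connected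
   exactly when F is algebraically closed in K. *)

Section FunctionFields.

Variables (F K : fieldType) (iota : {rmorphism F -> K}).

Definition transcendental_over (x : K) : Prop := ~ algebraicOver iota x.

(* K is finite over the subfield F(x), whose elements are the quotients
   u(x) / v(x) of polynomials with coefficients in F. *)
Definition finite_over_rational_functions (x : K) : Prop :=
  exists (n : nat) (e : 'I_n -> K), forall y : K,
    exists u v : 'I_n -> {poly F},
      (forall i, v i != 0) /\
      y = \sum_(i < n) (map_poly iota (u i)).[x] / (map_poly iota (v i)).[x]
                         * e i.

Definition function_field : Prop :=
  exists2 x : K, transcendental_over x & finite_over_rational_functions x.

Definition full_constant_field : Prop :=
  forall y : K, algebraicOver iota y -> exists c : F, y = iota c.

Record place (V : {pred K}) : Prop := Place {
  place_subring : subring_closed V;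
  place_constants : forall c : F, iota c \in V;
  place_proper : exists z : K, z \notin V;
  place_valuation : forall z : K, z != 0 -> z \in V \/ z^-1 \in V
}.

Definition place_ideal (V : {pred K}) : {pred K} :=
  [pred x | (x \in V) && ((x == 0) || (x^-1 \notin V))].

Definition rational_place (V : {pred K}) : Prop :=
  place V /\ forall x, x \in V -> exists c : F, x - iota c \in place_ideal V.

End FunctionFields.

Record pointed_curve (F : finFieldType) : Type := PointedCurve {
  curve_field : fieldType;
  curve_scalar : {rmorphism F -> curve_field};
  curve_infty : {pred curve_field};
  curve_function_field : function_field curve_scalar;
  curve_geom_connected : full_constant_field curve_scalar;
  curve_infty_rational : rational_place curve_scalar curve_infty
}.

Arguments curve_scalar {F} p.
Arguments curve_infty {F} p.

Section CoordinateRing.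

Variables (F : finFieldType) (X : pointed_curve F).

Definition regular_away_from_infty : {pred curve_field X} :=
  fun x => `[< forall V : {pred curve_field X}, place (curve_scalar X) V ->
                 ~ V =i curve_infty X -> x \in V >].

Fact regular_subring_closed : subring_closed regular_away_from_infty.
Proof.
split.
- by apply/asboolP => V /place_subring[].
- move=> x y /asboolP xP /asboolP yP; apply/asboolP => V Vp VN.
  by case: (place_subring Vp) => _ + _; apply; [exact: xP | exact: yP].
- move=> x y /asboolP xP /asboolP yP; apply/asboolP => V Vp VN.
  by case: (place_subring Vp) => _ _; apply; [exact: xP | exact: yP].
Qed.

HB.instance Definition _ := GRing.isSubringClosed.Build (curve_field X)
  regular_away_from_infty regular_subring_closed.

Record coord_ring : Type := CoordRing {
  coord_val :> curve_field X;
  _ : coord_val \in regular_away_from_infty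
}.

HB.instance Definition _ := [isSub for coord_val].
HB.instance Definition _ := [Choice of coord_ring by <:].
HB.instance Definition _ := [SubChoice_isSubComNzRing of coord_ring by <:].

Fact curve_scalar_regular (c : F) :
  curve_scalar X c \in regular_away_from_infty.
Proof. by apply/asboolP => V /place_constants. Qed.

Definition coord_scalar (c : F) : coord_ring :=
  CoordRing (curve_scalar_regular c).

Fact coord_scalar_is_zmod_morphism : zmod_morphism coord_scalar.
Proof. by move=> x y; apply: val_inj; rewrite /= rmorphB. Qed.

Fact coord_scalar_is_monoid_morphism : monoid_morphism coord_scalar.
Proof.
by split=> [|x y]; apply: val_inj; rewrite /= ?rmorph1 ?rmorphM.
Qed.

HB.instance Definition _ := GRing.isZmodMorphism.Build F coord_ring
  coord_scalar coord_scalar_is_zmod_morphism.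
HB.instance Definition _ := GRing.isMonoidMorphism.Build F coord_ring
  coord_scalar coord_scalar_is_monoid_morphism.

End CoordinateRing.

(* The type [idealr B] consists of the proper ideals of [B]. *)
Definition maximal_ideal (B : comNzRingType) (I : idealr B) : Prop :=
  forall J : idealr B, {subset I <= J} -> {subset J <= I}.

Fixpoint ideal_pow (B : comNzRingType) (I : {pred B}) (n : nat) : {pred B} :=
  if n is m.+1 then
    fun x => `[< exists s : seq (B * B),
      (forall z, z \in s -> z.1 \in I /\ z.2 \in ideal_pow I m) /\
      x = \sum_(z <- s) z.1 * z.2 >]
  else predT.

(* The inverse limit of the rings B / I^n, presented as the ring of the
   sequences a with a_(n+1) = a_n modulo I^n, modulo the ideal of the
   sequences with a_n = 0 modulo I^n. *)
Section Completion.

Variables (B : comNzRingType) (I : idealr B).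

Lemma ideal_pow0 n : 0 \in ideal_pow I n.
Proof. by case: n => // n; apply/asboolP; exists [::]; rewrite big_nil. Qed.

Lemma ideal_powD n x y : x \in ideal_pow I n -> y \in ideal_pow I n ->
  x + y \in ideal_pow I n.
Proof.
case: n => // n /asboolP[s [sP ->]] /asboolP[r [rP ->]]; apply/asboolP.
exists (s ++ r); rewrite big_cat; split=> // z.
by rewrite mem_cat => /orP[/sP|/rP].
Qed.

Lemma ideal_powM n a x : x \in ideal_pow I n -> a * x \in ideal_pow I n.
Proof.
case: n => // n /asboolP[s [sP ->]]; apply/asboolP.
exists [seq (a * z.1, z.2) | z <- s]; split.
  by move=> _ /mapP[z /sP[z1 z2] ->]; split=> //=; apply: idealMr.
by rewrite big_map mulr_sumr; apply: eq_bigr => z _; rewrite mulrA.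
Qed.

Lemma ideal_powB n x y : x \in ideal_pow I n -> y \in ideal_pow I n ->
  x - y \in ideal_pow I n.
Proof. by move=> xP yP; rewrite -mulN1r ideal_powD ?ideal_powM. Qed.

Lemma ideal_powSub n x : x \in ideal_pow I n.+1 -> x \in I.
Proof.
move=> /asboolP[s [sP ->]]; rewrite big_seq rpred_sum // => z /sP[z1 _].
by rewrite mulrC idealMr.
Qed.

Definition coherent : {pred nat -> B} :=
  fun a => `[< forall n, a n.+1 - a n \in ideal_pow I n >].

Fact coherent_subring_closed : subring_closed coherent.
Proof.
split.
- by apply/asboolP => n; rewrite subrr ideal_pow0.
- move=> a b /asboolP aP /asboolP bP; apply/asboolP => n.
  have -> : (a - b) n.+1 - (a - b) n = (a n.+1 - a n) - (b n.+1 - b n).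
    change (a n.+1 - b n.+1 - (a n - b n) = a n.+1 - a n - (b n.+1 - b n)).
    by rewrite !opprB addrACA [RHS]addrACA [- b _ - _]addrC.
  exact: ideal_powB.
- move=> a b /asboolP aP /asboolP bP; apply/asboolP => n.
  have -> : (a * b) n.+1 - (a * b) n =
            b n.+1 * (a n.+1 - a n) + a n * (b n.+1 - b n).
    by rewrite mulrBr mulrBr addrA ![b n.+1 * _]mulrC subrK.
  by rewrite ideal_powD ?ideal_powM.
Qed.

HB.instance Definition _ := GRing.isSubringClosed.Build (nat -> B)
  coherent coherent_subring_closed.

Record coherent_seq : Type := CoherentSeq {
  coherent_val :> nat -> B;
  _ : coherent_val \in coherent
}.

HB.instance Definition _ := [isSub for coherent_val].
HB.instance Definition _ := [Choice of coherent_seq by <:].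
HB.instance Definition _ := [SubChoice_isSubComNzRing of coherent_seq by <:].

Definition null_seq : {pred coherent_seq} :=
  fun a => `[< forall n, a n \in ideal_pow I n >].

Fact null_seq_idealr_closed : idealr_closed null_seq.
Proof.
split.
- by apply/asboolP => n; apply: ideal_pow0.
- by apply/asboolP => /(_ 1%N) /ideal_powSub; rewrite idealr1.
- move=> a u v /asboolP uP /asboolP vP; apply/asboolP => n.
  by apply: ideal_powD => //; apply: ideal_powM.
Qed.

HB.instance Definition _ := isIdealr.Build coherent_seq null_seq
  null_seq_idealr_closed.

Definition completion : Type := {ideal_quot null_seq}.

Fact const_coherent (x : B) : (fun _ : nat => x) \in coherent.
Proof. by apply/asboolP => n; rewrite subrr ideal_pow0. Qed.

Definition to_completion (x : B) : completion :=
  \pi_{ideal_quot null_seq}%qT (CoherentSeq (const_coherent x)).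

Fact to_completion_is_zmod_morphism : zmod_morphism to_completion.
Proof.
move=> x y; rewrite /to_completion -rmorphB; congr (\pi_(_) _)%qT.
by apply: val_inj.
Qed.

Fact to_completion_is_monoid_morphism : monoid_morphism to_completion.
Proof.
split=> [|x y]; rewrite /to_completion -?rmorphM.
  rewrite -[RHS](rmorph1 (\pi_{ideal_quot null_seq}%qT)).
  by congr (\pi_(_) _)%qT; apply: val_inj.
by congr (\pi_(_) _)%qT; apply: val_inj.
Qed.

HB.instance Definition _ := GRing.isZmodMorphism.Build B completion
  to_completion to_completion_is_zmod_morphism.
HB.instance Definition _ := GRing.isMonoidMorphism.Build B completion
  to_completion to_completion_is_monoid_morphism.

End Completion.

Section AdicConditions.

Variables (R : comPzRingType) (pi : R).

Definition in_multiples (a x : R) : Prop := exists c : R, x = a * c.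

(* The map from R to the inverse limit of the rings R / pi^n R is bijective. *)
Definition adically_complete : Prop :=
  forall x : nat -> R,
    (forall n, in_multiples (pi ^+ n) (x n.+1 - x n)) ->
    exists! y : R, forall n, in_multiples (pi ^+ n) (y - x n).

Definition torsion_free : Prop := forall x : R, pi * x = 0 -> x = 0.

Definition adically_null (b : nat -> R) : Prop :=
  forall n, exists N, forall i, (N <= i)%N -> in_multiples (pi ^+ n) (b i).

End AdicConditions.

Section Frobenius.

Variables (F : finFieldType) (R : comPzRingType) (iota : {rmorphism F -> R}).

Lemma exprD_card n x y :
  (x + y : R) ^+ (#|F| ^ n) = x ^+ (#|F| ^ n) + y ^+ (#|F| ^ n).
Proof.
have [R0 | R_neq0] := eqVneq (1 : R) 0.
  have triv z : z = 0 :> R by rewrite -[z]mulr1 R0 mulr0.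
  by rewrite [LHS]triv [RHS]triv.
pose R' : comNzRingType :=
  HB.pack_for comNzRingType R (GRing.PzSemiRing_isNonZero.Build R R_neq0).
pose iota' : {rmorphism F -> R'} := iota.
have [p p_pr pcharFp] := finPcharP F.
have pcharRp : p \in [pchar R'].
  by rewrite inE p_pr -(rmorph_nat iota') (pcharf0 pcharFp) rmorph0 /=.
apply: (@exprDn_pchar R'); rewrite pnatX; apply/orP; left.
rewrite (eq_pnat _ (pcharf_eq pcharRp)).
by have := abelem_pgroup (fin_ring_pchar_abelem pcharFp); rewrite /pgroup cardsT.
Qed.

Lemma expr0_card n : (0 : R) ^+ (#|F| ^ n) = 0.
Proof. by rewrite expr0n expn_eq0 (gtn_eqF (ltnW (finNzRing_gt1 F))). Qed.

Lemma expr_sum_card n (I : Type) (r : seq I) (f : I -> R) :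
  (\sum_(i <- r) f i) ^+ (#|F| ^ n) = \sum_(i <- r) f i ^+ (#|F| ^ n).
Proof. exact: (big_morph (fun x => x ^+ _) (exprD_card n) (expr0_card n)). Qed.

End Frobenius.

Definition adically_nullb (R : comPzRingType) (pi : R) : {pred nat -> R} :=
  fun b => `[< adically_null pi b >].

(* The ring R{tau}^: a series sum_i b_i tau^i is given by its coefficients
   b_i, which tend to 0 in the pi-adic topology, and multiplication is
   composition, determined by b tau^i o c tau^j = b c^(q^i) tau^(i+j) with
   q = #|F|.
   The coefficients do not depend on [iota], which is used to endow the
   type with its ring structure. *)
Record twisted_series (F : finFieldType) (R : comPzRingType)
    (iota : {rmorphism F -> R}) (pi : R) : Type := TwistedSeries {
  coef :> nat -> R;
  _ : coef \in adically_nullb pi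
}.

Section TwistedSeries.

Variables (F : finFieldType) (R : comPzRingType) (iota : {rmorphism F -> R}).
Variable pi : R.

Local Notation q := #|F|.

Lemma in_multiples0 (a : R) : in_multiples a 0.
Proof. by exists 0; rewrite mulr0. Qed.

Lemma in_multiplesD (a x y : R) :
  in_multiples a x -> in_multiples a y -> in_multiples a (x + y).
Proof. by move=> [c ->] [d ->]; exists (c + d); rewrite mulrDr. Qed.

Lemma in_multiplesM (a x y : R) : in_multiples a x -> in_multiples a (x * y).
Proof. by move=> [c ->]; exists (c * y); rewrite mulrA. Qed.

Lemma in_multiplesX (a x : R) n :
  (0 < n)%N -> in_multiples a x -> in_multiples a (x ^+ n).
Proof. by case: n => // n _ aP; rewrite exprS; apply: in_multiplesM. Qed.

Fact adically_null_zmod_closed : zmod_closed (adically_nullb pi).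
Proof.
split=> [|b c /asboolP bP /asboolP cP]; apply/asboolP => n.
  by exists 0%N => i _; apply: in_multiples0.
have [N NP] := bP n; have [M MP] := cP n; exists (maxn N M) => i.
rewrite geq_max => /andP[/NP bi /MP ci].
by apply: in_multiplesD => //; rewrite -mulrN1; apply: in_multiplesM.
Qed.

HB.instance Definition _ := GRing.isZmodClosed.Build (nat -> R)
  (adically_nullb pi) adically_null_zmod_closed.

Local Notation twisted_series := (twisted_series iota pi).

HB.instance Definition _ := [isSub for @coef F R iota pi].
HB.instance Definition _ := [Choice of twisted_series by <:].
HB.instance Definition _ := [SubChoice_isSubZmodule of twisted_series by <:].

Implicit Types f g h : twisted_series.

Lemma twisted_seriesP f g : coef f =1 coef g -> f = g.
Proof. by move=> fg; apply: val_inj; apply/funext. Qed.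

Lemma coefB f g k : coef (f - g) k = f k - g k.
Proof. by []. Qed.

Lemma coefD f g k : coef (f + g) k = f k + g k.
Proof. by []. Qed.

Fact monomial0_null (b : R) :
  (fun k => if k == 0%N then b else 0) \in adically_nullb pi.
Proof.
by apply/asboolP => n; exists 1%N => -[//|i] _; apply: in_multiples0.
Qed.

Definition tau0 (b : R) : twisted_series := TwistedSeries iota (monomial0_null b).

Definition comp_coef (f g : nat -> R) (k : nat) : R :=
  \sum_(i < k.+1) f i * g (k - i)%N ^+ (q ^ i).

Lemma q_gt0 i : (0 < q ^ i)%N.
Proof. by rewrite expn_gt0 (ltnW (finNzRing_gt1 F)). Qed.

Fact comp_null f g : comp_coef f g \in adically_nullb pi.
Proof.
case: f g => [f /asboolP fP] [g /asboolP gP] /=; apply/asboolP => n.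
have [N NP] := fP n; have [M MP] := gP n; exists (N + M)%N => k lek.
apply: (big_ind (in_multiples (pi ^+ n))) => [||i _].
- exact: in_multiples0.
- by move=> x y; apply: in_multiplesD.
have [leNi|ltiN] := leqP N i; first by apply: in_multiplesM; apply: NP.
rewrite mulrC; apply/in_multiplesM/in_multiplesX; rewrite ?q_gt0 //.
apply: MP; rewrite leq_subRL; last by rewrite -ltnS.
by apply: leq_trans lek; rewrite leq_add2r ltnW.
Qed.

Definition comp f g : twisted_series := TwistedSeries iota (comp_null f g).

Lemma comp_coef_rev (f g : nat -> R) k :
  comp_coef f g k = \sum_(i < k.+1) f (k - i)%N * g i ^+ (q ^ (k - i)).
Proof.
rewrite /comp_coef (reindex_inj rev_ord_inj) /=.
by apply: eq_bigr => i _; rewrite subSS subKn // -ltnS.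
Qed.

Fact compA : associative comp.
Proof.
move=> f g h; apply: twisted_seriesP => i /=; rewrite [RHS]comp_coef_rev.
pose coef3 j k :=
  f j * (g (i - j - k)%N ^+ (q ^ j) * h k ^+ (q ^ (i - k))).
transitivity (\sum_(j < i.+1) \sum_(k < i.+1 | (k <= i - j)%N) coef3 j k).
  apply: eq_bigr => /= j _.
  rewrite [X in X ^+ _]comp_coef_rev (expr_sum_card iota) big_distrr /=.
  rewrite (big_ord_narrow_leq (leq_subr _ _)) /=.
  apply: eq_bigr => k _; rewrite /coef3 /= exprMn -exprM -expnD.
  congr (_ * (_ * _ ^+ (_ ^ _))).
  have lekj : (k <= i - j)%N by rewrite -ltnS.
  have leji : (j <= i)%N by rewrite -ltnS.
  by rewrite addnC subnAC subnKC // leq_subRL ?(leq_trans lekj (leq_subr _ _)) //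
             addnC -leq_subRL.
rewrite (exchange_big_dep predT) //=; apply: eq_bigr => k _.
transitivity (\sum_(j < i.+1 | (j <= i - k)%N) coef3 j k).
  apply: eq_bigl => j; rewrite -ltnS -(ltnS j) -!subSn ?leq_ord //.
  by rewrite -subn_gt0 -(subn_gt0 j) -!subnDA addnC.
rewrite (big_ord_narrow_leq (leq_subr _ _)) big_distrl /=.
by apply: eq_bigr => j _; rewrite /coef3 /= -!subnDA addnC mulrA.
Qed.

Fact comp1f : left_id (tau0 1) comp.
Proof.
move=> f; apply: twisted_seriesP => k; rewrite /= /comp_coef big_ord_recl.
by rewrite big1 => [|j _]; rewrite /= ?mul0r // mul1r subn0 expr1 addr0.
Qed.

Fact compf1 : right_id (tau0 1) comp.
Proof.
move=> f; apply: twisted_seriesP => k; rewrite /= comp_coef_rev big_ord_recl.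
rewrite big1 => [|j _]; rewrite /= ?(expr0_card F R) ?mulr0 //.
by rewrite expr1n mulr1 subn0 addr0.
Qed.

Fact compDl : left_distributive comp +%R.
Proof.
move=> f g h; apply: twisted_seriesP => k; rewrite [RHS]coefD /= /comp_coef -big_split.
by apply: eq_bigr => j _; rewrite /= -mulrDl.
Qed.

Fact compDr : right_distributive comp +%R.
Proof.
move=> f g h; apply: twisted_seriesP => k; rewrite [RHS]coefD /= /comp_coef -big_split.
by apply: eq_bigr => j _; rewrite /= -mulrDr -(exprD_card iota).
Qed.

HB.instance Definition _ := GRing.Zmodule_isPzRing.Build twisted_series
  compA comp1f compf1 compDl compDr.

End TwistedSeries.

(* Here pi = theta t. *)
Section AdmissibleModules.

Variables (F : finFieldType) (A : comNzRingType) (iota : {rmorphism F -> A}).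
Variables (R : comPzRingType) (theta : {rmorphism A -> R}) (t : A).

Definition base_scalar : {rmorphism F -> R} := theta \o iota.

Local Notation series := (twisted_series base_scalar (theta t)).

Record admissible_module : Type := AdmissibleModule {
  module_action :> {rmorphism A -> series};
  module_action0 : forall a, coef (module_action a) 0 = theta a
}.

Implicit Types E G : admissible_module.

Definition A_linear E G (f : series) : Prop :=
  forall a : A, f * E a = G a * f.

Definition A_isomorphism E G (f : series) : Prop :=
  A_linear E G f /\ exists g : series, [/\ A_linear G E g, g * f = 1 & f * g = 1].

Definition Ga_action (a : A) : series :=
  tau0 base_scalar (theta t) (theta a).

Fact Ga_action_is_zmod_morphism : zmod_morphism Ga_action.
Proof.
move=> a b; apply: twisted_seriesP => -[|k]; rewrite coefB /= ?rmorphB //.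
by rewrite subrr.
Qed.

Fact Ga_action_is_monoid_morphism : monoid_morphism Ga_action.
Proof.
split=> [|a b]; apply: twisted_seriesP => k.
  by rewrite /= rmorph1.
rewrite /= /comp_coef big_ord_recl big1 ?addr0 /= ?subn0 ?expr1.
  by case: k => [|k]; rewrite /= ?rmorphM ?mulr0.
by move=> j _; rewrite mul0r.
Qed.

HB.instance Definition _ := GRing.isZmodMorphism.Build A series
  Ga_action Ga_action_is_zmod_morphism.
HB.instance Definition _ := GRing.isMonoidMorphism.Build A series
  Ga_action Ga_action_is_monoid_morphism.

Definition Ga : admissible_module :=
  @AdmissibleModule Ga_action (fun=> erefl).

End AdmissibleModules.

Arguments Ga {F A} iota {R} theta t.

(* Main.v *)
(** With q = #|F| and phi_E(t) = sum_i a_i tau^i, a_0 = pi, the identity f phi_E(t) = pi f says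
      pi (1 - pi^(q^k - 1)) b_k = sum_(i < k) b_i a_(k-i)^(q^i)   for all k.
    By completeness 1 - pi^(q^k - 1) is a unit, so torsion-freeness makes the
    b_k unique; they exist with b_k in pi^k R because the i-th summand lies in
    pi^(i + q^k - q^i) R and, as q >= 3, i + q^k - q^i > k.  A series with
    b_0 = 1 and b_k in pi^k R has an inverse of the same shape.  Finally
    f phi_E(a) f^-1 commutes with f phi_E(t) f^-1 = pi, hence is concentrated
    in degree 0, where it is theta(a): f is linear for all of A. *)
Require Import Defs.
From mathcomp Require Import all_boot all_order all_algebra.
From mathcomp Require Import boolp.
From mathcomp Require Import zify ring.

Set Implicit Arguments.
Unset Strict Implicit.
Unset Printing Implicit Defensive.

Import GRing.Theory.
Local Open Scope ring_scope.

(** * Estimates on exponents of [pi] *)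

Lemma addn1_leq_expB1 q m : (3 <= q)%N -> (0 < m)%N -> (m + 1 <= q ^ m - 1)%N.
Proof.
move=> q3; case: m => // m _; elim: m => [|m IH]; first by rewrite expn1; lia.
by rewrite expnS; nia.
Qed.

(** The right side is [q ^ i * (q ^ (k - i) - 1) - 1], with [q ^ (k - i) - 1] at least [k - i + 1].
    For q = 2 the bound fails at i = 0, k = 1. *)
Lemma subn_leq_expB q i k : (3 <= q)%N -> (i < k)%N ->
  (k - i <= q ^ k - q ^ i - 1)%N.
Proof.
move=> q3 ltik; have := @addn1_leq_expB1 q (k - i) q3.
have -> : (q ^ k = q ^ (k - i) * q ^ i)%N by rewrite -expnD subnK // ltnW.
have : (0 < q ^ i)%N by rewrite expn_gt0; lia.
rewrite subn_gt0 => ? /(_ ltik); nia.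
Qed.

(** * Complete rings and recursive sequences *)

Section AdicRing.

Variables (R : comPzRingType) (pi : R).

Lemma in_multiplesXW m n x :
  (m <= n)%N -> in_multiples (pi ^+ n) x -> in_multiples (pi ^+ m) x.
Proof.
move=> lemn [c ->]; rewrite -(subnKC lemn) exprD -mulrA.
by exists (pi ^+ (n - m) * c).
Qed.

Lemma in_multiples_sum (a : R) (I : finType) (f : I -> R) :
  (forall i, in_multiples a (f i)) -> in_multiples a (\sum_i f i).
Proof.
move=> fP; apply: big_ind => // [|x y]; first exact: in_multiples0.
exact: in_multiplesD.
Qed.

Lemma in_multiples_mulX m n x y : in_multiples (pi ^+ m) x ->
  in_multiples (pi ^+ n) y -> in_multiples (pi ^+ (m + n)) (x * y).
Proof. by move=> [c ->] [d ->]; exists (c * d); rewrite exprD mulrACA. Qed.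

Lemma adically_null_in_multiples (b : nat -> R) :
  (forall i, in_multiples (pi ^+ i) (b i)) -> b \in adically_nullb pi.
Proof. by move=> bP; apply/asboolP => n; exists n => i /in_multiplesXW; apply. Qed.

Lemma adic_separated : adically_complete pi ->
  forall x, (forall n, in_multiples (pi ^+ n) x) -> x = 0.
Proof.
move=> /(_ (fun=> 0)) cR x xP; case: cR => [n|y [_ yP]].
  by rewrite subrr; apply: in_multiples0.
rewrite -(yP x) => [|n]; last by rewrite subr0.
by apply: yP => n; rewrite subrr; apply: in_multiples0.
Qed.

(** The inverse is the limit of the geometric sums of [pi * y]; its defect from being an inverse
    lies in every [pi ^+ n] R, hence vanishes. *)
Lemma adic_unit : adically_complete pi -> forall y, exists u, (1 - pi * y) * u = 1.
Proof.
move=> cR y; have [n|u [uP _]] := cR (fun n => \sum_(i < n) (pi * y) ^+ i).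
  by rewrite big_ord_recr /= addrC addrK exprMn; exists (y ^+ n).
exists u; apply/subr0_eq/(adic_separated cR) => n; have [c uE] := uP n.
have := subrX1 (pi * y) n; rewrite exprMn => geom.
exists ((1 - pi * y) * c - y ^+ n).
rewrite mulrBr mulrCA -uE.
have -> : pi ^+ n * y ^+ n = 1 + (pi * y - 1) * \sum_(i < n) (pi * y) ^+ i.
  by rewrite -geom addrC subrK.
by ring.
Qed.

Lemma exists_recursive_seq (w : nat -> nat -> R) : exists b : nat -> R,
  b 0%N = 1 /\ forall k, (0 < k)%N -> b k = \sum_(i < k) b i * w i k.
Proof.
(* Course-of-values recursion: [B n] is correct at indices up to n and has the default value 1
   beyond; the diagonal is the sequence sought. *)
pose fix B n : nat -> R := if n is m.+1 then
    fun k => if k == m.+1 then \sum_(i < m.+1) B m i * w i m.+1 else B m k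
  else fun=> 1.
have stable n i : (i <= n)%N -> B n i = B i i.
  elim: n => [|n IH]; first by case: i.
  rewrite leq_eqVlt => /orP[/eqP-> // | ltin] /=.
  by rewrite ltn_eqF // IH.
exists (fun n => B n n); split=> // -[//|k] _ /=.
by rewrite eqxx; apply: eq_bigr => i _; rewrite stable // -ltnS.
Qed.

(** By strong induction the i-th summand gets [pi ^+ i] from [b i] and [pi ^+ (k - i)] from the
    weight. *)
Lemma recursive_seq_in_multiples (w : nat -> nat -> R) (b : nat -> R) :
  (forall i k, (i < k)%N -> in_multiples (pi ^+ (k - i)) (w i k)) ->
  (forall k, (0 < k)%N -> b k = \sum_(i < k) b i * w i k) ->
  forall k, in_multiples (pi ^+ k) (b k).
Proof.
move=> wP bE; elim/ltn_ind => -[|k] IH; first by exists (b 0%N); rewrite mul1r.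
rewrite bE //; apply: in_multiples_sum => i.
rewrite -[X in pi ^+ X](subnKC (ltnW (ltn_ord i))).
by apply: in_multiples_mulX; auto.
Qed.

End AdicRing.

(** * Twisted series and their inverses *)

Section Series.

Variables (F : finFieldType) (R : comPzRingType) (iota : {rmorphism F -> R}).
Variable pi : R.

Local Notation q := #|F|.
Local Notation series := (twisted_series iota pi).
Local Notation tau0 := (tau0 iota pi).

Implicit Types (f g : series) (c : R).

Lemma coefM f g k :
  coef (f * g) k = \sum_(i < k.+1) f i * g (k - i)%N ^+ (q ^ i).
Proof. by []. Qed.

Lemma coefM0 f g : coef (f * g) 0 = f 0%N * g 0%N.
Proof. by rewrite coefM big_ord1 expr1. Qed.

Lemma coef_mul_tau0 f c k : coef (f * tau0 c) k = f k * c ^+ (q ^ k).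
Proof.
rewrite coefM big_ord_recr /= subnn big1 ?add0r // => i _ /=.
by rewrite subn_eq0 leqNgt ltn_ord (expr0_card F R) mulr0.
Qed.

Lemma coef_tau0_mul f c k : coef (tau0 c * f) k = c * f k.
Proof.
rewrite coefM big_ord_recl /= subn0 expr1 big1 ?addr0 // => i _ /=.
by rewrite mul0r.
Qed.

Definition adic_unipotent f :=
  coef f 0 = 1 /\ forall i, in_multiples (pi ^+ i) (coef f i).

Lemma adic_unipotent_linv f :
  adic_unipotent f -> exists2 g, adic_unipotent g & g * f = 1.
Proof.
(* As f has constant term 1, coefficient k > 0 of [g * f = 1] can be solved for [g k]; [w] holds the
   resulting weights. *)
case=> f0 fP; pose w i k := - f (k - i)%N ^+ (q ^ i).
have [b [b0 bE]] := exists_recursive_seq w.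
have bP : forall k, in_multiples (pi ^+ k) (b k).
  apply: recursive_seq_in_multiples bE => i k ltik; rewrite /w -mulrN1.
  by apply: in_multiplesM; apply: in_multiplesX => //; apply: q_gt0.
exists (TwistedSeries iota (adically_null_in_multiples bP)) => //.
apply: twisted_seriesP => -[|k]; first by rewrite coefM0 /= b0 f0 mulr1.
rewrite coefM big_ord_recr /= subnn f0 expr1n mulr1 bE // -big_split big1 //=.
by move=> i _; rewrite mulrN subrr.
Qed.

(** The left inverse g is again unipotent, so has a left inverse h, and associativity forces h =
    f. *)
Lemma adic_unipotent_inv f : adic_unipotent f ->
  exists g, g * f = 1 /\ f * g = 1.
Proof.
move=> /adic_unipotent_linv[g /adic_unipotent_linv[h _ hg] gf].
exists g; split=> //; suff -> : f = h by [].
by rewrite -[f]mul1r -hg -mulrA gf mulr1.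
Qed.

(** * Series intertwining g with [tau0 pi] *)

Hypotheses (R_complete : adically_complete pi)
  (R_torsion_free : torsion_free pi).

(** Both sides are multiples by [pi * (1 - pi * pi ^+ (q ^ k - 2))]: torsion-freeness cancels the
    first factor, and the second is a unit. *)
Lemma adic_cancel k x y : (0 < k)%N ->
  pi * x - x * pi ^+ (q ^ k) = pi * y - y * pi ^+ (q ^ k) -> x = y.
Proof.
move=> k0 eqxy; have lt1 : (1 < q ^ k)%N.
  by rewrite -(exp1n k) ltn_exp2r // card_finNzRing_gt1.
have [u uE] := adic_unit R_complete (pi ^+ (q ^ k - 2)).
have qE : pi ^+ (q ^ k) = pi * (pi * pi ^+ (q ^ k - 2)).
  by rewrite -!exprS; congr (_ ^+ _); lia.
apply/subr0_eq; rewrite -[LHS]mulr1 -uE mulrA [X in X * u](_ : _ = 0) ?mul0r //.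
apply: R_torsion_free; move/eqP: eqxy; rewrite -subr_eq0 qE => /eqP <-.
by ring.
Qed.

Lemma commute_tau0 f : f * tau0 pi = tau0 pi * f -> f = tau0 (f 0%N).
Proof.
move=> fC; apply: twisted_seriesP => -[//|k] /=.
apply: (@adic_cancel k.+1) => //.
have : coef (f * tau0 pi) k.+1 = coef (tau0 pi * f) k.+1 by rewrite fC.
by rewrite coef_mul_tau0 coef_tau0_mul => ->; rewrite subrr mulr0 mul0r subrr.
Qed.

(** The term i = k of [f * g] is [f k * pi ^+ (q ^ k)]; moving it across leaves a recursion in lower
    coefficients. Degree 0 is commutativity of R. *)
Lemma intertwines_tau0P (f g : series) : g 0%N = pi ->
  (f * g = tau0 pi * f <-> forall k, (0 < k)%N ->
    pi * f k - f k * pi ^+ (q ^ k) = \sum_(i < k) f i * g (k - i)%N ^+ (q ^ i)).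
Proof.
move=> g0; have coefE k : coef (f * g) k =
    \sum_(i < k) f i * g (k - i)%N ^+ (q ^ i) + f k * pi ^+ (q ^ k).
  by rewrite coefM big_ord_recr /= subnn g0.
split=> [fg k _|fgP]; first by rewrite -coef_tau0_mul -fg coefE addrK.
apply: twisted_seriesP => k; rewrite coefE coef_tau0_mul.
case: k => [|k]; last by rewrite -fgP // subrK.
by rewrite big_ord0 add0r expr1 mulrC.
Qed.

Lemma intertwiner_unique (f1 f2 g : series) : g 0%N = pi ->
  f1 * g = tau0 pi * f1 -> f2 * g = tau0 pi * f2 -> f1 0%N = f2 0%N -> f1 = f2.
Proof.
move=> g0 /(intertwines_tau0P _ g0) f1P /(intertwines_tau0P _ g0) f2P f12.
apply: twisted_seriesP; elim/ltn_ind => -[//|k] IH.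
apply: (@adic_cancel k.+1) => //; rewrite f1P // f2P //.
by apply: eq_bigr => i _; rewrite IH.
Qed.

Lemma intertwiner_exists (g : series) : (3 <= q)%N -> g 0%N = pi ->
  (forall i, (0 < i)%N -> in_multiples (pi ^+ (q ^ i - 1)) (g i)) ->
  exists2 f, adic_unipotent f & f * g = tau0 pi * f.
Proof.
move=> q3 g0 gP.
(* [c i] is the quotient of [g i] by [pi ^+ (q ^ i - 1)], with dummy value 0 at i = 0. *)
have /choice[c cE] i : exists c, (0 < i)%N -> g i = pi ^+ (q ^ i - 1) * c.
  by case: i => [|i]; [exists 0 | have [//|c cE] := gP i.+1; exists c].
have [u uE] := choice (fun k => adic_unit R_complete (pi ^+ (q ^ k - 2))).
(* The weight is [g (k - i) ^+ (q ^ i)] divided by [pi * (1 - pi ^+ (q ^ k - 1))]: the power of [pi]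
   in the numerator has exponent [q ^ k - q ^ i], one is cancelled, and [u k] inverts the unit. *)
pose w i k := u k * (pi ^+ (q ^ k - q ^ i - 1) * c (k - i)%N ^+ (q ^ i)).
have [b [b0 bE]] := exists_recursive_seq w.
have bP : forall k, in_multiples (pi ^+ k) (b k).
  apply: recursive_seq_in_multiples bE => i k ltik; rewrite /w mulrCA.
  apply: in_multiplesM; apply: (in_multiplesXW (subn_leq_expB q3 ltik)).
  by exists 1; rewrite mulr1.
exists (TwistedSeries iota (adically_null_in_multiples bP)) => //.
apply/intertwines_tau0P => // k k0 /=.
have lt2 : (2 <= q ^ k)%N by have := addn1_leq_expB1 q3 k0; lia.
have -> : pi ^+ (q ^ k) = pi * (pi * pi ^+ (q ^ k - 2)).
  by rewrite -!exprS; congr (_ ^+ _); lia.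
transitivity (pi * (1 - pi * pi ^+ (q ^ k - 2)) * b k); first by ring.
rewrite bE // mulr_sumr; apply: eq_bigr => i _; rewrite /w.
have ltik := ltn_ord i.
rewrite cE ?subn_gt0 // exprMn -exprM.
have -> : ((q ^ (k - i) - 1) * q ^ i = (q ^ k - q ^ i - 1).+1)%N.
  rewrite mulnBl mul1n -expnD subnK ?(ltnW ltik) // subn1 prednK // subn_gt0.
  by rewrite ltn_exp2l // card_finNzRing_gt1.
rewrite exprS; set x := pi ^+ _; set y := pi ^+ _; set z := c _ ^+ _.
transitivity ((1 - pi * x) * u k * (b i * (pi * y * z))); first by ring.
by rewrite uE mul1r.
Qed.

End Series.

(** * From linearity at t to linearity over A *)

Section Admissible.

Variables (F : finFieldType) (A : comNzRingType) (iota : {rmorphism F -> A}).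
Variables (R : comPzRingType) (theta : {rmorphism A -> R}) (t : A).
Variable E : admissible_module iota theta t.
Hypotheses (R_complete : adically_complete (theta t))
  (R_torsion_free : torsion_free (theta t)).

Local Notation series := (twisted_series (base_scalar iota theta) (theta t)).
Local Notation G := (Ga iota theta t).

Lemma A_linear_of_gen (f g : series) : g * f = 1 -> f * g = 1 ->
  f 0%N = 1 -> f * E t = G t * f -> A_linear E G f.
Proof.
move=> gf fg f0 ft a.
have g0 : g 0%N = 1.
  have : coef (g * f) 0 = 1 by rewrite gf.
  by rewrite coefM0 f0 mulr1.
have tE : f * E t * g = G t by rewrite ft -mulrA fg mulr1.
have : f * E a * g = G a.
  have := @commute_tau0 _ _ (base_scalar iota theta) _ R_complete
    R_torsion_free (f * E a * g).
  rewrite !coefM0 f0 g0 mul1r mulr1 module_action0; apply.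
  (* [tau0] of [theta t] is [G t], the conjugate of [E t]; conjugation by f is multiplicative, so
     commutation follows from that of A. *)
  change (f * E a * g * G t = G t * (f * E a * g)); rewrite -tE.
  have conjM x y : f * E x * g * (f * E y * g) = f * E (x * y) * g.
    by rewrite rmorphM !mulrA -(mulrA _ g f) gf mulr1.
  by rewrite !conjM mulrC.
by move=> <-; rewrite -(mulrA (f * E a)) gf mulr1.
Qed.

Lemma A_isomorphism_of_inv (E1 E2 : admissible_module iota theta t)
    (f g : series) :
  A_linear E1 E2 f -> g * f = 1 -> f * g = 1 -> A_isomorphism E1 E2 f.
Proof.
move=> fA gf fg; split=> //; exists g; split=> // a.
by rewrite -[LHS]mulr1 -fg mulrA -(mulrA g) -fA !mulrA gf mul1r.
Qed.

End Admissible.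

Theorem theorem5p6
  (F : finFieldType) (X : pointed_curve F)
  (P : idealr (coord_ring X)) (P_max : maximal_ideal P)
  (t : coord_ring X) (t_in : t \in P) (t_notin : t \notin ideal_pow P 2)
  (R : comPzRingType) (alpha : {rmorphism completion P -> R})
  (theta : {rmorphism coord_ring X -> R} := alpha \o to_completion P)
  (pi : R := theta t)
  (R_complete : adically_complete pi) (R_torsion_free : torsion_free pi)
  (E : admissible_module (@coord_scalar F X) theta t)
  (q_ge3 : (3 <= #|F|)%N)
  (E_small : forall i, (1 <= i)%N ->
     in_multiples (pi ^+ (#|F| ^ i - 1)) (coef (E t) i)) :
  exists f : twisted_series (base_scalar (@coord_scalar F X) theta) pi,
    unique (fun g : twisted_series (base_scalar (@coord_scalar F X) theta) pi =>
              [/\ A_linear E (Ga (@coord_scalar F X) theta t) g,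
                  forall i, in_multiples (pi ^+ i) (coef g i)
                & coef g 0 = 1]) f
    /\ A_isomorphism E (Ga (@coord_scalar F X) theta t) f.
Proof.
have Et0 : coef (E t) 0 = pi by apply: module_action0.
have [f [f0 fP] ft] := intertwiner_exists R_complete q_ge3 Et0 E_small.
have [g [gf fg]] := adic_unipotent_inv (conj f0 fP).
have fA := A_linear_of_gen R_complete R_torsion_free gf fg f0 ft.
exists f; split; last exact: A_isomorphism_of_inv fA gf fg.
split=> // h [hA _ h0].
by apply: intertwiner_unique Et0 ft (hA t) _; rewrite // f0 h0.
Qed.
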